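(* Let $X$ be a non-negative absolutely continuous random variable with probability density function $f$ on $(0,\infty)$, let $\omega\ge 0$ be a weight function, and let $\beta\ge1$. Then, for all $a,b>0$, the random variable $Y=aX+b$ satisfies $$I_\beta^\omega(aX+b)=\frac{1}{a^{\beta-1}}\int_0^\infty \omega(ax+b)f^\beta(x)\,dx .$$
   Context: For a non-negative absolutely continuous random variable $X$ with density $f$, a measurable weight $\omega\ge0$ and $\beta\ge1$, the general weighted information generating function (GWIGF) is $I_\beta^\omega(X)=\int_0^\infty \omega(u)f^\beta(u)\,du$. All integrals appearing are assumed to exist. *)

(* Defs.v *)
From HB Require Import structures.
From mathcomp Require Import all_boot all_order all_algebra.
From mathcomp Require Import all_classical all_reals all_analysis measurable_realfun.

Set Implicit Arguments.
Unset Strict Implicit.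
Unset Printing Implicit Defensive.

Import Order.TTheory GRing.Theory Num.Theory.
Import numFieldNormedType.Exports.

Local Open Scope classical_set_scope.
Local Open Scope ring_scope.
Local Open Scope ereal_scope.

Definition is_pdf d (T : measurableType d) (R : realType)
    (P : probability T R) (X : {RV P >-> R}) (f : R -> R) : Prop :=
  [/\ measurable_fun [set: R] f,
      (forall x, (0 <= f x)%R) &
      forall A : set R, measurable A ->
        distribution P X A = \int[lebesgue_measure]_(x in A) (f x)%:E].

(* A density is determined only up to a null set: pdf picks one version, with
   value 0 everywhere if X has no density. *)
Definition pdf d (T : measurableType d) (R : realType)
    (P : probability T R) (X : {RV P >-> R}) : R -> R :=
  xget (cst 0%R) [set f | is_pdf X f].

Definition gwigf d (T : measurableType d) (R : realType)
    (P : probability T R) (X : {RV P >-> R}) (beta : R) (omega : R -> R) : \bar R :=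
  \int[lebesgue_measure]_(u in `]0%R, +oo[) (omega u * pdf X u `^ beta)%:E.

Lemma is_pdf_ae_eq d (T : measurableType d) (R : realType) (P : probability T R)
    (X : {RV P >-> R}) (f g : R -> R) (D : set R) : measurable D ->
  is_pdf X f -> is_pdf X g ->
  ae_eq lebesgue_measure D (EFin \o f) (EFin \o g).
Proof.
move=> mD [mf f0 fE] [mg g0 gE].
apply: integral_ae_eq => //.
- apply/integrableP; split; first by apply/measurable_EFinP/measurable_funTS.
  under eq_integral do rewrite /= ger0_norm//.
  by rewrite -fE// (le_lt_trans (probability_le1 _ _))// ltry.
- by apply/measurable_EFinP/measurable_funTS.
- by move=> E _ mE; rewrite -fE// -gE.
Qed.

(* gwigf does not depend on the version of the density. *)
Lemma gwigfE d (T : measurableType d) (R : realType) (P : probability T R)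
    (X : {RV P >-> R}) (f : R -> R) (beta : R) (omega : R -> R) :
  is_pdf X f ->
  measurable_fun (`]0%R, +oo[ : set R) omega ->
  gwigf X beta omega =
  \int[lebesgue_measure]_(u in `]0%R, +oo[) (omega u * f u `^ beta)%:E.
Proof.
move=> Xf mo; have Xg : is_pdf X (pdf X) := xgetI (cst 0%R) Xf.
have mint h : is_pdf X h ->
    measurable_fun (`]0%R, +oo[ : set R) (fun u : R => (omega u * h u `^ beta)%:E).
  case=> mh _ _; apply/measurable_EFinP/measurable_funM => //.
  by apply: (measurableT_comp (measurable_powR beta)); exact: measurable_funTS.
apply: ae_eq_integral => //; [exact: mint|exact: mint|].
apply: filterS (is_pdf_ae_eq (measurable_itv `]0%R, +oo[) Xg Xf) => u /= + u0.
by move=> /(_ u0) [->].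
Qed.

(* Main.v *)
(* A density of aX + b is a^-1 f((u - b)/a). The substitution u = ax + b then
   turns the GWIGF of aX + b into an integral over ]-b/a, +oo[, where the factor
   f^beta kills the part ]-b/a, 0] because f vanishes almost everywhere there,
   X being nonnegative. *)
Require Import Defs.
From mathcomp Require Import all_boot all_order all_algebra.
From mathcomp Require Import all_classical all_reals all_analysis measurable_realfun.
Import Order.TTheory GRing.Theory Num.Theory.
Import numFieldNormedType.Exports.
Local Open Scope classical_set_scope.
Local Open Scope ring_scope.
Local Open Scope ereal_scope.

Lemma measurable_affine (R : realType) (a b : R) :
  measurable_fun [set: R] ((fun x => a * x + b)%R : R -> R).
Proof. by apply: measurable_funD => //; exact: measurable_funM. Qed.

(** By uniqueness of Lebesgue measure: the pushforward of Lebesgue measure along [x |-> a * x + b],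
    rescaled by [a], gives every interval []c, e]] its length. *)
Lemma lebesgue_measure_affine (R : realType) (a b : R) (A : set R) :
  (0 < a)%R -> measurable A ->
  lebesgue_measure A =
  a%:E * lebesgue_measure ((fun x => a * x + b)%R @^-1` A : set R).
Proof.
move=> a_gt0 mA.
pose phi := (fun x => a * x + b)%R : R -> measurableTypeR R.
have mphi : measurable_fun setT phi := measurable_affine R a b.
apply: (@lebesgue_measure_unique _ (mscale (NngNum (ltW a_gt0))
  (pushforward lebesgue_measure phi))) => //=.
- move=> _ [[c e]] _ <-.
  rewrite /mscale/= /pushforward /phi.
  rewrite (_ : _ @^-1` _ = `]((c - b) / a)%R, ((e - b) / a)%R]%classic); last first.
    apply/seteqP; split => x /=; rewrite !in_itv/= ler_pdivlMr// ltr_pdivrMr//;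
      by rewrite ltrBlDr lerBrDr (mulrC x).
  (* As [a > 0], the interval and its preimage are empty together, so one case split on [c < e]
     serves both lengths. *)
  rewrite !lebesgue_measure_itv/= !lte_fin ltr_pM2r ?invr_gt0// ltrD2r.
  case: ifPn => _; last by rewrite mule0.
  rewrite -!EFinB -EFinM; congr EFin.
  by rewrite -mulrBl opprB addrA subrK mulrC divfK ?gt_eqF.
Qed.

(** Substitution [y = a * x + b]: the right side is an integral against the rescaled pushforward,
    which is Lebesgue measure by the previous lemma. *)
Lemma ge0_integral_affine (R : realType) (a b : R) (a_gt0 : (0 < a)%R)
    (D : set R) (h : R -> \bar R) : measurable D -> measurable_fun D h ->
  (forall y, D y -> 0 <= h y) ->
  \int[lebesgue_measure]_(y in D) h y =
  a%:E * \int[lebesgue_measure]_(x in (fun x => a * x + b)%R @^-1` D)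
           h (a * x + b)%R.
Proof.
move=> mD mh h_ge0.
pose phi := (fun x => a * x + b)%R : R -> measurableTypeR R.
have mphi : measurable_fun setT phi := measurable_affine R a b.
have -> : \int[lebesgue_measure]_(x in phi @^-1` D) h (phi x) =
    \int[pushforward lebesgue_measure phi]_(y in D) h y.
  by rewrite ge0_integral_pushforward// => y; rewrite inE; exact: h_ge0.
rewrite -(ge0_integral_mscale _ _ (NngNum (ltW a_gt0)))//.
by apply: eq_measure_integral => A mA _; exact: lebesgue_measure_affine.
Qed.

(** [Y] lies in [A] exactly when [X] lies in the preimage of [A]; after substitution the Jacobian
    [a] cancels the factor [a^-1]. *)
Lemma is_pdf_affine {d} {T : measurableType d} {R : realType}
    {P : probability T R} {X Y : {RV P >-> R}} {f : R -> R} {a b : R} :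
  (0 < a)%R -> (forall t, Y t = a * X t + b)%R -> is_pdf X f ->
  is_pdf Y (fun u => a^-1 * f ((u - b) / a))%R.
Proof.
move=> a_gt0 YE [mf f_ge0 fE].
have g_ge0 u : (0 <= a^-1 * f ((u - b) / a))%R by rewrite mulr_ge0// invr_ge0 ltW.
have mg : measurable_fun setT (fun u : R => a^-1 * f ((u - b) / a))%R.
  apply: measurable_funM => //; apply: (measurableT_comp mf).
  by apply: measurable_funM => //; exact: measurable_funB.
split=> // A mA.
have mphiA : measurable ((fun x => a * x + b)%R @^-1` A).
  by rewrite -[X in measurable X]setTI; exact: measurable_affine.
transitivity (distribution P X ((fun x => a * x + b)%R @^-1` A)).
  by rewrite /distribution /pushforward; congr (P _);
    apply/seteqP; split=> t /=; rewrite YE.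
rewrite fE// [RHS](@ge0_integral_affine _ a b)//; last 2 first.
- by apply/measurable_EFinP; exact: measurable_funTS.
- by move=> y _; rewrite lee_fin; exact: g_ge0.
rewrite -ge0_integralZl//; last 3 first.
- apply/measurable_EFinP; apply: measurable_funTS.
  exact: (measurableT_comp mg (measurable_affine R a b)).
- by move=> y _; rewrite lee_fin; exact: g_ge0.
- by rewrite lee_fin ltW.
apply: eq_integral => x _.
by rewrite -EFinM addrK [(a * x)%R]mulrC mulfK ?gt_eqF// mulrA divff ?gt_eqF// mul1r.
Qed.

Lemma is_pdf_ae_eq0_npos {d} {T : measurableType d} {R : realType}
    {P : probability T R} {X : {RV P >-> R}} {f : R -> R} :
  {ae P, forall t, (0 <= X t)%R} -> is_pdf X f ->
  ae_eq lebesgue_measure (`]-oo, 0%R]%classic : set R) (EFin \o f) (cst 0).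
Proof.
move=> X_ge0 [mf f_ge0 fE].
have mEf D : measurable_fun D (EFin \o f).
  by apply/measurable_EFinP; exact: measurable_funTS.
apply/(ae_eq_integral_abs lebesgue_measure (measurable_itv `]-oo, 0%R])) => //.
  exact: mEf.
under eq_integral do rewrite /= ger0_norm//.
(* Dropping the endpoint 0 leaves the integral unchanged and turns it into the probability of
   [X < 0], which is null, whereas [X <= 0] is not known to be. *)
rewrite -integral_itv_bndo_bndc// -fE//.
case: X_ge0 => N [mN PN0 subN]; apply: (subset_measure0 _ _ _ PN0) => //.
- by rewrite -[X in measurable X]setTI; exact: measurable_funP.
- by move=> t /=; rewrite in_itv/= => Xt; apply: subN; rewrite /= leNgt Xt.
Qed.

Theorem proposition2p1 (d : measure_display) (T : measurableType d) (R : realType)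
    (P : probability T R) (X : {RV P >-> R}) (f omega : R -> R) (beta : R)
    (X_ge0 : {ae P, forall t, (0 <= X t)%R})
    (X_pdf : is_pdf X f)
    (omega_ge0 : forall u : R, (0 < u)%R -> (0 <= omega u)%R)
    (omega_meas : measurable_fun (`]0%R, +oo[ : set R) omega)
    (beta_ge1 : (1 <= beta)%R) (a b : R) (a_gt0 : (0 < a)%R) (b_gt0 : (0 < b)%R) :
  gwigf (a *: X + cst b : {RV P >-> R})%R beta omega =
  ((a `^ (beta - 1))^-1)%:E *
  \int[lebesgue_measure]_(x in `]0%R, +oo[) (omega (a * x + b) * f x `^ beta)%:E.
Proof.
have [mf f_ge0 _] := X_pdf.
have a0 : a != 0%R by rewrite gt_eqF.
have g_pdf := @is_pdf_affine _ _ _ _ _ (a *: X + cst b)%R _ _ _ a_gt0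
  (fun=> erefl) X_pdf.
(* The version chosen by [pdf] is replaced by the explicit density. *)
rewrite (gwigfE _ g_pdf omega_meas).
pose phi := (fun x => a * x + b)%R : R -> R.
have phi_pos : phi @^-1` `]0%R, +oo[ = `](- b / a)%R, +oo[%classic.
  have phi_gt0 x : (0 < phi x)%R = (- b / a < x)%R.
    by rewrite /phi ltr_pdivrMr// -[RHS]subr_gt0 opprK mulrC.
  by apply/seteqP; split=> x; rewrite /= !in_itv/= !andbT phi_gt0.
pose h u := (omega u * (a^-1 * f ((u - b) / a)) `^ beta)%:E.
pose k x := (omega (a * x + b) * f x `^ beta)%:E.
have mh : measurable_fun (`]0%R, +oo[ : set R) h.
  apply/measurable_EFinP/measurable_funM => //.
  apply: (measurableT_comp (measurable_powR beta)); apply: measurable_funTS.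
  by case: g_pdf.
have mk : measurable_fun `](- b / a)%R, +oo[%classic k.
  apply/measurable_EFinP/measurable_funM.
    apply: (measurable_comp (measurable_itv `]0%R, +oo[)) => //.
      by rewrite -phi_pos => _ [x + <-].
    by apply: measurable_funTS; exact: measurable_affine.
  by apply: (measurableT_comp (measurable_powR beta)); exact: measurable_funTS.
(* The sign of [omega] is known only at positive arguments, and [a * x + b] is positive exactly on
   this interval. *)
have k_ge0 x : `](- b / a)%R, +oo[%classic x -> 0 <= k x.
  rewrite -phi_pos /= in_itv/= andbT => xb.
  by rewrite lee_fin mulr_ge0 ?powR_ge0// omega_ge0.
rewrite (@ge0_integral_affine _ a b a_gt0 _ h)//; last first.
  move=> y /=; rewrite in_itv/= andbT => y0.
  by rewrite lee_fin mulr_ge0 ?powR_ge0// omega_ge0.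
rewrite -/phi phi_pos.
have hk x : h (a * x + b)%R = (a^-1 `^ beta)%:E * k x.
  rewrite /h /k -EFinM addrK [(a * x)%R]mulrC mulfK// powRM ?invr_ge0 ?(ltW a_gt0)//.
  by rewrite mulrCA.
under eq_integral do rewrite hk.
rewrite ge0_integralZl//; last by rewrite lee_fin powR_ge0.
rewrite muleA -EFinM.
(* The Jacobian [a] meets the factor [a^-1] of the density raised to [beta]; both are written as
   powers of [a], with total exponent [1 - beta]. *)
have -> : (a * a^-1 `^ beta = (a `^ (beta - 1))^-1)%R.
  rewrite -powR_inv1 ?ltW// -powRrM mulN1r -{1}(powRr1 (ltW a_gt0)).
  by rewrite -powRD ?a0 ?implybT// -powRN opprB.
congr (_ * _).
(* Since [b > 0], the domain starts left of 0; it is split at 0 to isolate the part where [f]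
   vanishes almost everywhere. *)
have ba_lt0 : (- b / a < 0)%R by rewrite pmulr_llt0 ?invr_gt0// oppr_lt0.
have itvE : `](- b / a)%R, +oo[%classic =
    `](- b / a)%R, 0%R] `|` `]0%R, +oo[ :> set R.
  by rewrite -itv_bndbnd_setU// bnd_simp ltW.
rewrite itvE ge0_integral_setU//; last 3 first.
- by rewrite -itvE.
- by move=> x; rewrite -itvE; exact: k_ge0.
- apply/disj_setPS => x [/=]; rewrite !in_itv/= => /andP[_ x0].
  by rewrite andbT ltNge x0.
rewrite [X in X + _](_ : _ = 0) ?add0e//.
have sub_itv : `](- b / a)%R, 0%R] `<=` `](- b / a)%R, +oo[%classic.
  by rewrite itvE; exact: subsetUl.
rewrite (@ae_eq_integral _ _ _ _ _ (cst 0))// ?integral0//.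
  exact: measurable_funS mk.
apply: filterS (is_pdf_ae_eq0_npos X_ge0 X_pdf) => x /= fx0.
rewrite in_itv/= => /andP[_ x0]; rewrite in_itv/= in fx0.
have [fx_eq0] := fx0 x0.
(* Here [beta >= 1] gives [beta != 0], which matters because a zero exponent would make the power of
   0 equal to 1. *)
by rewrite /k fx_eq0 powR0 ?mulr0// gt_eqF// (lt_le_trans _ beta_ge1).
Qed.
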